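(* Let $R$ be a ring with finite left pure global dimension. Then $\mathsf{K}(\mathsf{PureProj}\,R)$ is compactly generated. In particular, if $R$ is left pure-semisimple, then $\mathsf{K}(\mathsf{Mod}\,R)$ is compactly generated.
   Context: Modules are left $R$-modules; $\mathsf{Mod}\,R$ is the category of all of them. A sequence $Y$ of modules is pure exact if $\operatorname{Hom}_R(N,Y)$ is exact for every finitely presented module $N$. A module $P$ is pure projective if $\operatorname{Hom}_R(P,-)$ preserves exactness of pure exact sequences; $\mathsf{PureProj}\,R$ is the class of pure projective modules. The left pure global dimension of $R$ is the least $d$ (or $\infty$) such that every left module $N$ has a pure exact sequence $0\to P_d\to\cdots\to P_0\to N\to0$ with all $P_i$ pure projective. $R$ is left pure-semisimple if its left pure global dimension is $0$, i.e. every left module is pure projective. For a class $\mathbb{X}$ of modules closed under set-indexed coproducts and direct summands, $\mathsf{K}(\mathbb{X})$ is the triangulated category with objects the ($\mathbb{Z}$-indexed) chain complexes of modules from $\mathbb{X}$ and morphisms the chain maps modulo homotopy. A triangulated category $\mathsf{T}$ with set-indexed coproducts is compactly generated if there is a set $\mathcal{G}$ of compact objects (objects $C$ for which $\coprod_i\operatorname{Hom}_{\mathsf T}(C,X_i)\to\operatorname{Hom}_{\mathsf T}(C,\coprod_iX_i)$ is always an isomorphism) such that, for all $X\in\mathsf{T}$, $\operatorname{Hom}_{\mathsf T}(G,X)=0$ for all $G\in\mathcal{G}$ implies $X\cong0$. *)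

(* Defs.v *)
From HB Require Import structures.
From mathcomp Require Import all_boot all_order all_algebra.
From mathcomp Require Import boolp classical_sets functions cardinality fsbigop.

Set Implicit Arguments.
Unset Strict Implicit.
Unset Printing Implicit Defensive.

Import Order.TTheory GRing.Theory Num.Theory.

Local Open Scope ring_scope.
Local Open Scope quotient_scope.

(* "Sets" are the types living in the universe of the carriers of modules.
   Index types of coproducts and generating families are taken there: with a
   bare [Type] the family of all objects would itself be a legal index. *)
Definition small_type := Type@{GRing.Lmodule.axioms_.u0}.

(** * Preadditive categories and compact generation *)

Record preadditive := Preadditive {
  obj :> Type;
  hom : obj -> obj -> zmodType;
  idn : forall X, hom X X;
  comp : forall X Y Z, hom Y Z -> hom X Y -> hom X Z;
  comp_idl : forall X Y (f : hom X Y), comp (idn Y) f = f;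
  comp_idr : forall X Y (f : hom X Y), comp f (idn X) = f;
  comp_assoc : forall X Y Z W (h : hom Z W) (g : hom Y Z) (f : hom X Y),
    comp h (comp g f) = comp (comp h g) f;
  comp_addl : forall X Y Z (g g' : hom Y Z) (f : hom X Y),
    comp (g + g') f = comp g f + comp g' f;
  comp_addr : forall X Y Z (g : hom Y Z) (f f' : hom X Y),
    comp g (f + f') = comp g f + comp g f' }.

Arguments idn {p} X.
Arguments comp {p X Y Z} g f.

Section Preadditive.
Variable T : preadditive.

(* X is isomorphic to 0; zero morphisms exist anyway, so this says that X is
   both initial and terminal. *)
Definition is_zero_object (X : T) : Prop :=
  forall Y : T, (forall f : hom X Y, f = 0) /\ (forall f : hom Y X, f = 0).

Definition is_coproduct (I : small_type) (X : I -> T) (S : T)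
    (inj : forall i, hom (X i) S) : Prop :=
  forall (Y : T) (f : forall i, hom (X i) Y),
    exists! g : hom S Y, forall i, comp g (inj i) = f i.

Definition has_coproducts : Prop :=
  forall (I : small_type) (X : I -> T),
    exists (S : T) (inj : forall i, hom (X i) S), is_coproduct inj.

Definition direct_sum (I : small_type) (V : I -> zmodType) : Type :=
  {f : forall i, V i | finite_set [set i | f i <> 0]}.

(* The canonical map \coprod_i Hom(C, X i) -> Hom(C, S) induced by
   inj : X i -> S; the sum is over the finite support of the family. *)
Definition coproduct_comparison (C : T) (I : small_type) (X : I -> T) (S : T)
    (inj : forall i, hom (X i) S) (f : direct_sum (fun i => hom C (X i))) :
    hom C S :=
  \sum_(i \in [set: {classic I}]) comp (inj i) (sval f i).

Definition compact (C : T) : Prop :=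
  forall (I : small_type) (X : I -> T) (S : T) (inj : forall i, hom (X i) S),
    is_coproduct inj -> bijective (coproduct_comparison (C := C) inj).

Definition compactly_generated : Prop :=
  has_coproducts /\
  exists (J : small_type) (G : J -> T),
    (forall j, compact (G j)) /\
    forall X : T, (forall j (f : hom (G j) X), f = 0) -> is_zero_object X.

End Preadditive.

(** * Complexes *)

(* Differentials lower the degree by one: d_n : X_{n+1} -> X_n. *)
Record complex (R : pzRingType) := Complex {
  term :> int -> lmodType R;
  diff : forall n, {linear term (n + 1) -> term n};
  diff_diff : forall n x, diff n (diff (n + 1) x) = 0 }.

Arguments diff {R} c n.

Section ChainMaps.
Variable R : pzRingType.

Lemma linear_ext (U V : lmodType R) (f g : {linear U -> V}) : f =1 g -> f = g.
Proof.
case: f g => f cf [g cg] /= /funext fg; case: _ / fg cg => cg.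
congr GRing.Linear.Pack.
case: cf cg => [[a] [b]] [[a'] [b']].
by rewrite (Prop_irrelevance a a') (Prop_irrelevance b b').
Qed.

Record chain_map (X Y : complex R) := ChainMap {
  chain_fun :> forall n, {linear X n -> Y n};
  chain_comm : forall n x,
    chain_fun n (diff X n x) = diff Y n (chain_fun (n + 1) x) }.

Lemma chain_ext (X Y : complex R) (f g : chain_map X Y) :
  (forall n, f n =1 g n) -> f = g.
Proof.
case: f g => f cf [g cg] /= fg.
have e : f = g.
  by apply: functional_extensionality_dep => n; apply: linear_ext; apply: fg.
by case: _ / e cg {fg} => cg; rewrite (Prop_irrelevance cf cg).
Qed.

Definition chain_id X : chain_map X X :=
  @ChainMap X X (fun n => idfun) (fun n x => erefl).

Program Definition chain_comp X Y Z (g : chain_map Y Z) (f : chain_map X Y) :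
  chain_map X Z := @ChainMap X Z (fun n => g n \o f n) _.
Next Obligation. by rewrite /= !chain_comm. Qed.

Program Definition chain_zero X Y : chain_map X Y :=
  @ChainMap X Y (fun n => \0) _.
Next Obligation. by rewrite /= linear0. Qed.

Program Definition chain_add X Y (f g : chain_map X Y) : chain_map X Y :=
  @ChainMap X Y (fun n => f n \+ g n) _.
Next Obligation. by rewrite /= !chain_comm linearD. Qed.

Program Definition chain_opp X Y (f : chain_map X Y) : chain_map X Y :=
  @ChainMap X Y (fun n => \- f n) _.
Next Obligation. by rewrite /= !chain_comm linearN. Qed.

Section Zmodule.
Variables X Y : complex R.

HB.instance Definition _ := gen_eqMixin (chain_map X Y).
HB.instance Definition _ := gen_choiceMixin (chain_map X Y).

Fact chain_addA : associative (@chain_add X Y).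
Proof. by move=> f g h; apply: chain_ext => n x /=; rewrite addrA. Qed.

Fact chain_addC : commutative (@chain_add X Y).
Proof. by move=> f g; apply: chain_ext => n x /=; rewrite addrC. Qed.

Fact chain_add0 : left_id (@chain_zero X Y) (@chain_add X Y).
Proof. by move=> f; apply: chain_ext => n x /=; rewrite add0r. Qed.

Fact chain_addN : left_inverse (@chain_zero X Y) (@chain_opp X Y) (@chain_add X Y).
Proof. by move=> f; apply: chain_ext => n x /=; rewrite addNr. Qed.

HB.instance Definition _ := GRing.isZmodule.Build (chain_map X Y)
  chain_addA chain_addC chain_add0 chain_addN.

(* The range of n + 1 is the whole of int. *)
Definition null_homotopic (f : chain_map X Y) : Prop :=
  exists s : forall n, {linear X n -> Y (n + 1)},
    forall n x, f (n + 1) x = diff Y (n + 1) (s (n + 1) x) + s n (diff X n x).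

Definition null_homotopicb (f : chain_map X Y) : bool := `[< null_homotopic f >].

Fact null_homotopic_closed : zmod_closed null_homotopicb.
Proof.
split=> [|f g /asboolP[s fs] /asboolP[t gt]]; apply/asboolP.
  by exists (fun n => \0) => n x /=; rewrite linear0 addr0.
exists (fun n => s n \- t n) => n x /=.
by rewrite fs gt linearB opprD addrACA.
Qed.

HB.instance Definition _ :=
  GRing.isZmodClosed.Build (chain_map X Y) null_homotopicb null_homotopic_closed.

Definition homotopy_class : Type :=
  Quotient.quot (GRing.ZmodClosed.clone _ null_homotopicb _).

HB.instance Definition _ := GRing.Zmodule.on homotopy_class.
HB.instance Definition _ := EqQuotient.on homotopy_class.

Definition htp_pi (f : chain_map X Y) : homotopy_class := \pi_homotopy_class f.

Lemma htp_eqP (f g : chain_map X Y) :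
  htp_pi f = htp_pi g <-> null_homotopic (f - g).
Proof.
rewrite -[null_homotopic _]asboolE; split.
  by move=> /eqP; rewrite -Quotient.idealrBE.
by move=> fg; apply/eqP; rewrite -Quotient.idealrBE.
Qed.

Lemma htp_piD (f g : chain_map X Y) : htp_pi (f + g) = htp_pi f + htp_pi g.
Proof. exact: Quotient.pi_add. Qed.

Lemma htp_ind (P : homotopy_class -> Prop) :
  (forall f, P (htp_pi f)) -> forall a, P a.
Proof. by move=> Pf a; rewrite -[a]reprK; exact: Pf. Qed.

End Zmodule.

Definition htp_comp X Y Z (b : homotopy_class Y Z) (a : homotopy_class X Y) :
    homotopy_class X Z :=
  htp_pi (chain_comp (repr b) (repr a)).

Lemma htp_compE X Y Z (g : chain_map Y Z) (f : chain_map X Y) :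
  htp_comp (htp_pi g) (htp_pi f) = htp_pi (chain_comp g f).
Proof.
have [s gs] : null_homotopic (repr (htp_pi g) - g).
  by apply/htp_eqP; exact: reprK.
have [t ft] : null_homotopic (repr (htp_pi f) - f).
  by apply/htp_eqP; exact: reprK.
rewrite /htp_comp; move: (repr _) (repr _) ft gs => g' f' ft gs.
apply/htp_eqP.
exists (fun n => (g' (n + 1) \o t n) \+ (s n \o f n)) => n x /=.
have -> : g' (n + 1) (f' (n + 1) x) - g (n + 1) (f (n + 1) x)
  = g' (n + 1) ((f' - f) (n + 1) x) + (g' - g) (n + 1) (f (n + 1) x).
  by rewrite /= linearB addrA subrK.
by rewrite ft gs !linearD !chain_comm addrACA.
Qed.

Fact htp_comp_idl X Y (a : homotopy_class X Y) :
  htp_comp (htp_pi (chain_id Y)) a = a.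
Proof.
by elim/htp_ind: a => f; rewrite htp_compE; congr htp_pi; exact: chain_ext.
Qed.

Fact htp_comp_idr X Y (a : homotopy_class X Y) :
  htp_comp a (htp_pi (chain_id X)) = a.
Proof.
by elim/htp_ind: a => f; rewrite htp_compE; congr htp_pi; exact: chain_ext.
Qed.

Fact htp_compA X Y Z W (c : homotopy_class Z W) (b : homotopy_class Y Z)
  (a : homotopy_class X Y) : htp_comp c (htp_comp b a) = htp_comp (htp_comp c b) a.
Proof.
elim/htp_ind: c => h; elim/htp_ind: b => g; elim/htp_ind: a => f.
by rewrite !htp_compE; congr htp_pi; exact: chain_ext.
Qed.

Fact htp_compDl X Y Z (b b' : homotopy_class Y Z) (a : homotopy_class X Y) :
  htp_comp (b + b') a = htp_comp b a + htp_comp b' a.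
Proof.
elim/htp_ind: b => g; elim/htp_ind: b' => g'; elim/htp_ind: a => f.
by rewrite -htp_piD !htp_compE -htp_piD; congr htp_pi; exact: chain_ext.
Qed.

Fact htp_compDr X Y Z (b : homotopy_class Y Z) (a a' : homotopy_class X Y) :
  htp_comp b (a + a') = htp_comp b a + htp_comp b a'.
Proof.
elim/htp_ind: b => g; elim/htp_ind: a => f; elim/htp_ind: a' => f'.
rewrite -htp_piD !htp_compE -htp_piD; congr htp_pi; apply: chain_ext => n x /=.
by rewrite linearD.
Qed.

(* K(F) for a class F of modules. *)
Definition homotopy_category (F : lmodType R -> Prop) : preadditive :=
  @Preadditive {X : complex R | forall n, F (X n)}
    (fun X Y => homotopy_class (sval X) (sval Y))
    (fun X => htp_pi (chain_id (sval X)))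
    (fun X Y Z => @htp_comp (sval X) (sval Y) (sval Z))
    (fun X Y => @htp_comp_idl (sval X) (sval Y))
    (fun X Y => @htp_comp_idr (sval X) (sval Y))
    (fun X Y Z W => @htp_compA (sval X) (sval Y) (sval Z) (sval W))
    (fun X Y Z => @htp_compDl (sval X) (sval Y) (sval Z))
    (fun X Y Z => @htp_compDr (sval X) (sval Y) (sval Z)).

End ChainMaps.

(** * Purity *)

Section Purity.
Variable R : pzRingType.

(* There is an exact sequence R^m -> R^n -> N -> 0. *)
Definition finitely_presented (N : lmodType R) : Prop :=
  exists (m n : nat) (f : {linear 'rV[R]_m -> 'rV[R]_n})
         (g : {linear 'rV[R]_n -> N}),
    (forall y, exists x, g x = y) /\
    (forall x, g x = 0 <-> exists z, f z = x).

(* Exactness of Hom(N, Y). A finite sequence is regarded as a complex by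
   extending it with zero modules. *)
Definition hom_exact (N : lmodType R) (Y : complex R) : Prop :=
  forall n (f : {linear N -> Y (n + 1)}), (forall x, diff Y n (f x) = 0) ->
    exists g : {linear N -> Y (n + 1 + 1)}, forall x, diff Y (n + 1) (g x) = f x.

Definition pure_exact (Y : complex R) : Prop :=
  forall N : lmodType R, finitely_presented N -> hom_exact N Y.

Definition pure_projective (P : lmodType R) : Prop :=
  forall Y : complex R, pure_exact Y -> hom_exact P Y.

(* A pure exact sequence 0 -> P_d -> ... -> P_0 -> N -> 0 with all P_i pure
   projective; P_i is in degree i and N, up to isomorphism, in degree -1. *)
Definition has_pure_resolution (N : lmodType R) (d : nat) : Prop :=
  exists Y : complex R,
    [/\ pure_exact Y,
        exists e : {linear Y (-1) -> N}, bijective e,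
        forall i : nat, (i <= d)%N -> pure_projective (Y i%:Z) &
        forall n : int, n < -1 \/ d%:Z < n -> forall x : Y n, x = 0].

Definition pure_resolutions_of_length (d : nat) : Prop :=
  forall N : lmodType R, has_pure_resolution N d.

End Purity.

(* The left pure global dimension, with None standing for infinity. *)
Definition pure_gldim (R : pzRingType) : option nat :=
  match pselect (exists d, `[< pure_resolutions_of_length R d >]) with
  | left ex_d => Some (ex_minn ex_d)
  | right _ => None
  end.

Definition finite_pure_gldim (R : pzRingType) : Prop := pure_gldim R <> None.

Definition left_pure_semisimple (R : pzRingType) : Prop := pure_gldim R = Some 0%N.

(* K(PureProj R) and K(Mod R) *)
Definition K_PureProj (R : pzRingType) : preadditive :=
  homotopy_category (@pure_projective R).

Definition K_Mod (R : pzRingType) : preadditive :=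
  homotopy_category (fun _ : lmodType R => True).

(* Main.v *)
From HB Require Import structures.
From mathcomp Require Import all_boot all_order all_algebra.
From mathcomp Require Import boolp classical_sets functions cardinality fsbigop.
Require Import Defs.

(** A finitely presented module M, placed in a single degree n, is an object of
    K(PureProj R), and Hom(M[n], X) is the homology of Hom(M, X) in degree n.
    As M is finitely generated, every map from M[n] to a coproduct of complexes
    has its image in finitely many summands, which makes M[n] compact.  The
    generators are the M[n], with M in a set of representatives of the finitely
    presented modules: if every map from every M[n] to X is null-homotopic, then
    X is pure exact ([stalk_detects]).

    It remains to see that a pure exact complex X of pure projective modules is
    contractible, and here the bound d on the pure dimension enters
    ([pure_exact_contractible]).  Above a module Z of cycles, X is a pure
    projective resolution of Z, and so is a resolution P of length d.  The
    comparison maps g : X -> P and f : P -> X have f g homotopic to the identity,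
    and f g = 0 above degree d because P vanishes there.  The homotopy then splits
    X in the degrees in question; as Z may be taken arbitrarily far down, X splits
    everywhere, and a complex that splits everywhere is contractible.

    In dimension 0 every module is pure projective, so that K(Mod R) is
    K(PureProj R). *)

Set Implicit Arguments.
Unset Strict Implicit.
Unset Printing Implicit Defensive.

Import GRing.Theory.

Local Open Scope ring_scope.
Local Open Scope classical_set_scope.

(** * Finite sums and linear maps *)

Lemma fsumE (I : choiceType) (V : nmodType) (s : seq I) (F : I -> V) :
    uniq s -> (forall i, i \notin s -> F i = 0) ->
  \sum_(i \in [set: I]) F i = \sum_(i <- s) F i.
Proof.
move=> us F0; rewrite (fsbigE s) => // [|i _ /F0 //].
by apply: eq_bigl => i; rewrite in_setT.
Qed.

Section LinearMaps.
Variable R : pzRingType.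
Implicit Types U V W : lmodType R.

(** Many maps below are only characterised by their values, so that existence of
    a packed linear map is all that is needed. *)
Lemma linear_of (U V : lmodType R) (h : U -> V) :
  (forall a x y, h (a *: x + y) = a *: h x + h y) ->
  exists f : {linear U -> V}, f =1 h.
Proof.
move=> lin_h.
pose m := GRing.isLinear.Build R U V _ h lin_h.
pose f : {linear U -> V} := HB.pack h m.
by exists f.
Qed.

Lemma factor_through U V W (p : {linear U -> V}) (h : {linear U -> W}) :
    (forall y, exists x, p x = y) -> (forall x, p x = 0 -> h x = 0) ->
  exists k : {linear V -> W}, forall x, k (p x) = h x.
Proof.
move=> /choice[r pr] ker.
have rp x : h (r (p x)) = h x.
  by apply/eqP; rewrite -subr_eq0 -linearB ker // linearB /= pr subrr.
have [k kE] : exists k : {linear V -> W}, k =1 h \o r.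
  apply: linear_of => a x y /=.
  by rewrite -linearP -[X in r X](_ : p (a *: r x + r y) = _) ?rp // linearP /= !pr.
by exists k => x; rewrite kE /= rp.
Qed.

Lemma linear_bij_inv U V (e : {linear U -> V}) :
  bijective e -> exists e' : {linear V -> U}, cancel e e' /\ cancel e' e.
Proof.
move=> [r er re].
have [x|x ex0|e' e'e] := @factor_through U V U e idfun; first by exists (r x).
  by rewrite /= -(er x) ex0 -[LHS]er re -[X in r X](linear0 e) er.
by exists e'; split=> // y; rewrite -{1}(re y) e'e /= re.
Qed.

End LinearMaps.

Section Kernel.
Variables (R : pzRingType) (U V : lmodType R) (f : {linear U -> V}).

Definition in_kernel : {pred U} := fun x => f x == 0.

Fact in_kernel_closed : submod_closed in_kernel.
Proof.
split; first by apply/eqP; rewrite linear0.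
by move=> a x y /eqP fx /eqP fy; apply/eqP; rewrite linearP fx fy scaler0 addr0.
Qed.

HB.instance Definition _ := GRing.isSubmodClosed.Build R U in_kernel in_kernel_closed.

Definition kernel := {x : U | x \in in_kernel}.

HB.instance Definition _ := SubChoice.on kernel.
HB.instance Definition _ := [SubChoice_isSubLmodule of kernel by <:].

Lemma kernelP (x : kernel) : f (val x) = 0.
Proof. exact/eqP/(valP x). Qed.

Lemma kernel_lift (W : lmodType R) (h : {linear W -> U}) :
  (forall x, f (h x) = 0) -> exists k : {linear W -> kernel}, forall x, val (k x) = h x.
Proof.
move=> fh0; have hK x : h x \in in_kernel by apply/eqP.
pose g x : kernel := exist _ (h x) (hK x).
have [a x y|k kE] := @linear_of R W kernel g.
  apply: val_inj; rewrite [RHS](linearP (val : kernel -> U)).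
  exact: (linearP h).
by exists k => x; rewrite kE.
Qed.

End Kernel.

(** * Direct sums of modules *)

Section Families.
Variables (I : small_type) (V : I -> zmodType).
Implicit Types x y : direct_sum V.

Definition Dsum (f : forall i, V i) (fin : finite_set [set i | f i <> 0]) :
    direct_sum V :=
  exist (fun f : forall i, V i => finite_set [set i | f i <> 0]) f fin.

Lemma dsum_ext x y : (forall i, sval x i = sval y i) -> x = y.
Proof.
case: x y => f ? [g ?] /= fg; apply: eq_exist.
exact: functional_extensionality_dep.
Qed.

Lemma dsum_support x :
  exists s : seq {classic I}, uniq s /\ forall i, i \notin s -> sval x i = 0.
Proof.
have /(@finite_seqP {classic I})[s sE] := svalP x.
exists (undup s); split; first exact: undup_uniq.
move=> i; rewrite mem_undup; apply: contraNeq => /eqP xi.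
by have : [set i | sval x i <> 0] i by []; rewrite sE.
Qed.

Lemma finite_family (f : forall i, V i) (s : seq {classic I}) :
  (forall i, i \notin s -> f i = 0) -> finite_set [set i | f i <> 0].
Proof.
move=> f0; apply: (@sub_finite_set _ _ [set` s]); last exact: finite_seq.
by move=> i /= fi; apply: contrapT => /negP /f0.
Qed.

(** The equality on I is not decidable: the entry at j is v transported along
   a proof of i = j if there is one. *)
Definition single i (v : V i) (j : I) : V j :=
  match pselect (i = j) with
  | left e => ecast k (V k) e v
  | right _ => 0
  end.

Lemma single_id i (v : V i) : single v i = v.
Proof.
by rewrite /single; case: pselect => // e; rewrite (Prop_irrelevance e erefl).
Qed.

Lemma single_neq i (v : V i) j : i <> j -> single v j = 0.
Proof. by rewrite /single; case: pselect. Qed.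

End Families.
Arguments single {I} V i v j.

Section DirectSum.
Variables (R : pzRingType) (I : small_type) (V : I -> lmodType R).

Definition dsum := direct_sum V.

Implicit Types x y : dsum.

Fact dsum0_finite : finite_set [set i : I | (0 : V i) <> 0].
Proof. exact: (@finite_family _ _ _ [::]). Qed.

Definition dsum0 : dsum := Dsum dsum0_finite.

Fact dsumD_finite x y : finite_set [set i | sval x i + sval y i <> 0].
Proof.
have [[s [_ x0]] [t [_ y0]]] := (dsum_support x, dsum_support y).
apply: (@finite_family _ _ _ (s ++ t)) => i; rewrite mem_cat => /norP[/x0-> /y0->].
exact: addr0.
Qed.

Definition dsumD x y : dsum := Dsum (dsumD_finite x y).

Fact dsumZ_finite (a : R) x : finite_set [set i | a *: sval x i <> 0].
Proof.
have [s [_ x0]] := dsum_support x.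
by apply: (@finite_family _ _ _ s) => i /x0->; rewrite scaler0.
Qed.

Definition dsumZ a x : dsum := Dsum (dsumZ_finite a x).

HB.instance Definition _ := gen_eqMixin dsum.
HB.instance Definition _ := gen_choiceMixin dsum.

Fact dsumA : associative dsumD.
Proof. by move=> x y z; apply: dsum_ext => i /=; rewrite addrA. Qed.

Fact dsumC : commutative dsumD.
Proof. by move=> x y; apply: dsum_ext => i /=; rewrite addrC. Qed.

Fact dsum0D : left_id dsum0 dsumD.
Proof. by move=> x; apply: dsum_ext => i /=; rewrite add0r. Qed.

Fact dsumND : left_inverse dsum0 (dsumZ (- 1)) dsumD.
Proof. by move=> x; apply: dsum_ext => i /=; rewrite scaleN1r addNr. Qed.

HB.instance Definition _ := GRing.isZmodule.Build dsum dsumA dsumC dsum0D dsumND.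

Fact dsumZA a b x : dsumZ a (dsumZ b x) = dsumZ (a * b) x.
Proof. by apply: dsum_ext => i /=; rewrite scalerA. Qed.

Fact dsum1Z : left_id 1 dsumZ.
Proof. by move=> x; apply: dsum_ext => i /=; rewrite scale1r. Qed.

Fact dsumZDr : right_distributive dsumZ +%R.
Proof. by move=> a x y; apply: dsum_ext => i /=; rewrite scalerDr. Qed.

Fact dsumZDl x : {morph dsumZ^~ x : a b / a + b}.
Proof. by move=> a b; apply: dsum_ext => i /=; rewrite scalerDl. Qed.

HB.instance Definition _ :=
  GRing.Zmodule_isLmodule.Build R dsum dsumZA dsum1Z dsumZDr dsumZDl.

Section Component.
Variable i : I.

Definition dsum_proj x : V i := sval x i.

Fact dsum_proj_linear : linear dsum_proj.
Proof. by []. Qed.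

HB.instance Definition _ :=
  GRing.isLinear.Build R dsum (V i) _ dsum_proj dsum_proj_linear.

(** Packed while the family is a variable: at a family such as fun i => X i n the
    linear structure of the projection is not inferred. *)
Definition dsum_proj_lin : {linear dsum -> V i} := dsum_proj.

Fact dsum_inj_finite v : finite_set [set j | single V i v j <> 0].
Proof.
apply: (@finite_family _ _ _ [:: i : {classic I}]) => j; rewrite inE => /eqP ji.
by apply: single_neq => ij; apply: ji.
Qed.

Definition dsum_inj v : dsum := Dsum (dsum_inj_finite v).

Fact dsum_inj_linear : linear dsum_inj.
Proof.
move=> a u v; apply: dsum_ext => j /=; have [<-|ij] := pselect (i = j).
  by rewrite !single_id.
by rewrite !single_neq // scaler0 addr0.
Qed.

HB.instance Definition _ :=
  GRing.isLinear.Build R (V i) dsum _ dsum_inj dsum_inj_linear.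

(** Packed for the same reason as the projection. *)
Definition dsum_inj_lin : {linear V i -> dsum} := dsum_inj.

End Component.

Lemma dsum_decomp x (s : seq {classic I}) :
    uniq s -> (forall i, i \notin s -> sval x i = 0) ->
  x = \sum_(i <- s) dsum_inj (dsum_proj i x).
Proof.
move=> us x0; apply: dsum_ext => j.
have proj_sum (F : {classic I} -> dsum) :
    sval (\sum_(i <- s) F i) j = \sum_(i <- s) sval (F i) j.
  exact: (raddf_sum (dsum_proj j)).
rewrite proj_sum; have [js|js] := boolP ((j : {classic I}) \in s).
  rewrite (bigD1_seq (j : {classic I})) //= single_id big1 ?addr0 // => i /eqP ij.
  exact: single_neq.
rewrite x0 // big1_seq // => i /andP[_ si]; apply: single_neq => ij.
by move: js; rewrite -ij si.
Qed.

Lemma dsum_linear_ext (W : lmodType R) (f g : {linear dsum -> W}) :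
  (forall i (v : V i), f (dsum_inj v) = g (dsum_inj v)) -> f =1 g.
Proof.
move=> fg x; have [s [us x0]] := dsum_support x.
by rewrite (dsum_decomp us x0) !linear_sum; apply: eq_bigr.
Qed.

Lemma dsum_copair (W : lmodType R) (f : forall i, {linear V i -> W}) :
  exists g : {linear dsum -> W}, forall i (v : V i), g (dsum_inj v) = f i v.
Proof.
pose h x := \sum_(i \in [set: {classic I}]) f i (dsum_proj i x).
have hE x (s : seq {classic I}) : uniq s -> (forall i, i \notin s -> sval x i = 0) ->
    h x = \sum_(i <- s) f i (dsum_proj i x).
  by move=> us x0; apply: fsumE => // i /x0 xi; rewrite /dsum_proj xi linear0.
have [a x y|g gE] := @linear_of R dsum W h.
  have [[s [_ x0]] [t [_ y0]]] := (dsum_support x, dsum_support y).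
  have ur := undup_uniq (s ++ t).
  have {}x0 i : i \notin undup (s ++ t) -> sval x i = 0.
    by rewrite mem_undup mem_cat => /norP[/x0].
  have {}y0 i : i \notin undup (s ++ t) -> sval y i = 0.
    by rewrite mem_undup mem_cat => /norP[_ /y0].
  rewrite !(hE _ (undup (s ++ t))) //; last first.
    by move=> i /[dup]/x0 xi /y0 yi; rewrite /= xi yi scaler0 addr0.
  by rewrite scaler_sumr -big_split; apply: eq_bigr => i _; rewrite !linearP.
exists g => i v; rewrite gE (hE _ [:: i]) ?big_seq1 /dsum_proj /= ?single_id //.
by move=> j; rewrite inE => /eqP ji; apply: single_neq => ij; apply: ji.
Qed.

End DirectSum.
Arguments dsum {R I} V.
Arguments dsum_proj {R I} V i.
Arguments dsum_inj {R I} V i.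
Arguments dsum_proj_lin {R I} V i.
Arguments dsum_inj_lin {R I} V i.

Section DirectSumMap.
Variables (R : pzRingType) (I : small_type) (V W : I -> lmodType R).
Variable f : forall i, {linear V i -> W i}.

Fact dsum_map_finite (x : dsum V) : finite_set [set i | f i (sval x i) <> 0].
Proof.
have [s [_ x0]] := dsum_support x.
by apply: (@finite_family _ _ _ s) => i /x0->; rewrite linear0.
Qed.

Definition dsum_map (x : dsum V) : dsum W := Dsum (dsum_map_finite x).

Fact dsum_map_linear : linear dsum_map.
Proof. by move=> a x y; apply: dsum_ext => i /=; rewrite linearP. Qed.

HB.instance Definition _ :=
  GRing.isLinear.Build R (dsum V) (dsum W) _ dsum_map dsum_map_linear.

Lemma dsum_map_inj i (v : V i) : dsum_map (dsum_inj V i v) = dsum_inj W i (f i v).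
Proof.
apply: dsum_ext => j /=; have [<-|ij] := pselect (i = j).
  by rewrite !single_id.
by rewrite !single_neq // linear0.
Qed.

End DirectSumMap.

Lemma hom_exact_dsum (R : pzRingType) (I : small_type) (V : I -> lmodType R)
    (Y : complex R) :
  (forall i, hom_exact (V i) Y) -> hom_exact (dsum V) Y.
Proof.
move=> VY n f df0.
have [g gE] := dsum_copair (fun i =>
  sval (cid (VY i n (f \o dsum_inj V i) (fun v => df0 _)))).
exists g => x.
by apply: (dsum_linear_ext (f := diff Y (n + 1) \o g)) => i v /=; rewrite gE; case: cid.
Qed.

(** * Coproducts and compact objects *)

Section PreadditiveCoproducts.
Variable T : preadditive.

Lemma comp_0l (X Y Z : T) (f : hom X Y) : comp (0 : hom Y Z) f = 0.
Proof. by apply: (addrI (comp 0 f)); rewrite -comp_addl !addr0. Qed.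

Lemma comp_0r (X Y Z : T) (g : hom Y Z) : comp g (0 : hom X Y) = 0.
Proof. by apply: (addrI (comp g 0)); rewrite -comp_addr !addr0. Qed.

Lemma comp_sumr (X Y Z : T) (g : hom Y Z) (J : Type) (s : seq J) (F : J -> hom X Y) :
  comp g (\sum_(i <- s) F i) = \sum_(i <- s) comp g (F i).
Proof.
by apply: (big_morph (comp g)) => [f f'|]; [exact: comp_addr|exact: comp_0r].
Qed.

Variables (I : small_type) (X : I -> T).

Lemma coproduct_comparisonE (C S : T) (inj : forall i, hom (X i) S)
    (f : direct_sum (fun i => hom C (X i))) (s : seq {classic I}) :
    uniq s -> (forall i, i \notin s -> sval f i = 0) ->
  coproduct_comparison inj f = \sum_(i <- s) comp (inj i) (sval f i).
Proof.
move=> us f0; apply: fsumE => // i /f0->; exact: comp_0r.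
Qed.

(** A coproduct in a preadditive category has projections onto its summands, and
    they recover the components of a finite sum.  So only surjectivity is at
    stake in compactness. *)
Lemma coproduct_comparison_inj (C S : T) (inj : forall i, hom (X i) S) :
  is_coproduct inj -> injective (coproduct_comparison (C := C) inj).
Proof.
move=> coS f g fg; apply: dsum_ext => j.
(* The family of Kronecker deltas induces the projection p from S to X j. *)
pose delta := single (fun i => hom (X i) (X j)) j (idn (X j)).
have [p [pE _]] := coS (X j) delta.
suff key (h : direct_sum (fun i => hom C (X i))) :
    sval h j = comp p (coproduct_comparison inj h) by rewrite !key fg.
have [r [ur h0]] := dsum_support h.
rewrite (coproduct_comparisonE _ ur h0) comp_sumr.
under eq_bigr do rewrite comp_assoc pE.
have [jr|jr] := boolP ((j : {classic I}) \in r).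
  rewrite (bigD1_seq (j : {classic I})) //= /delta single_id comp_idl big1 ?addr0 // => i ij.
  by rewrite single_neq ?comp_0l // => ji; move: ij; rewrite ji eqxx.
rewrite h0 // big1_seq // => i /andP[_ ri]; rewrite /delta single_neq ?comp_0l // => ji.
by move: jr; rewrite ji ri.
Qed.

End PreadditiveCoproducts.

(** Coproducts are unique up to isomorphism, so surjectivity has to be checked
    on one coproduct of each family only. *)
Lemma compact_of_surj (T : preadditive) (C : T) :
    (forall (I : small_type) (X : I -> T),
      exists (S : T) (inj : forall i, hom (X i) S), is_coproduct inj /\
        forall h : hom C S, exists f, coproduct_comparison inj f = h) ->
  compact C.
Proof.
move=> surjC I X S' inj' coS'.
have [S [inj [coS surjS]]] := surjC I X.
have [v [vE _]] := coS S' inj'; have [u [uE _]] := coS' S inj.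
have vu : comp v u = idn S'.
  have [w [_ wU]] := coS' S' inj'.
  rewrite -(wU (comp v u)) => [|i]; first by apply: wU => i; rewrite comp_idl.
  by rewrite -comp_assoc uE vE.
have surj h : exists f, coproduct_comparison (C := C) inj' f = h.
  have [f fE] := surjS (comp u h); exists f.
  have [s [us f0]] := dsum_support f.
  rewrite (coproduct_comparisonE _ us f0).
  under eq_bigr do rewrite -vE -comp_assoc.
  by rewrite -comp_sumr -(coproduct_comparisonE _ us f0) fE comp_assoc vu comp_idl.
pose r h := sval (cid (surj h)).
have rK : cancel r (coproduct_comparison inj') by move=> h; rewrite /r; case: cid.
exists r => // f; apply: (coproduct_comparison_inj coS'); exact: rK.
Qed.

Section ChainSums.
Variables (R : pzRingType) (X Y : complex R).

Lemma chain_sumE (J : Type) (s : seq J) (F : J -> chain_map X Y) n x :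
  (\sum_(i <- s) F i) n x = \sum_(i <- s) F i n x.
Proof. by elim/big_rec2: _ => //= i y f _ <-. Qed.

Lemma htp_pi0 : htp_pi (0 : chain_map X Y) = 0.
Proof. by apply: (addrI (htp_pi 0)); rewrite -htp_piD !addr0. Qed.

Lemma htp_pi_sum (J : Type) (s : seq J) (F : J -> chain_map X Y) :
  htp_pi (\sum_(i <- s) F i) = \sum_(i <- s) htp_pi (F i).
Proof. exact: (big_morph _ (@htp_piD _ X Y) htp_pi0). Qed.

End ChainSums.

(** * Direct sums of complexes *)

Section SumComplex.
Variables (R : pzRingType) (I : small_type) (X : I -> complex R).

Program Definition sum_complex : complex R :=
  @Complex R (fun n => dsum (fun i => X i n))
    (fun n => dsum_map (fun i => diff (X i) n)) _.
Next Obligation. by apply: dsum_ext => i /=; exact: diff_diff. Qed.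

Program Definition sum_inj i : chain_map (X i) sum_complex :=
  @ChainMap R (X i) sum_complex (fun n => dsum_inj_lin (fun i => X i n) i) _.
Next Obligation. exact/esym/(dsum_map_inj (fun i => diff (X i) n)). Qed.

Definition sum_proj i : chain_map sum_complex (X i) :=
  @ChainMap R sum_complex (X i) (fun n => dsum_proj_lin (fun i => X i n) i)
    (fun n x => erefl).

Lemma sum_copair (Y : complex R) (f : forall i, chain_map (X i) Y) :
  exists g : chain_map sum_complex Y, forall i, chain_comp g (sum_inj i) = f i.
Proof.
pose g n := sval (cid (dsum_copair (fun i => f i n))).
have gE n i (x : X i n) : g n (dsum_inj (fun i => X i n) i x) = f i n x.
  by rewrite /g; case: cid.
have gC n x : g n (diff sum_complex n x) = diff Y n (g (n + 1) x).
  pose d : {linear _ -> dsum (fun i => X i n)} := dsum_map (fun i => diff (X i) n).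
  apply: (@dsum_linear_ext _ _ _ _ (g n \o d) (diff Y n \o g (n + 1)%R)) => i v /=.
  by rewrite dsum_map_inj !gE chain_comm.
by exists (ChainMap gC) => i; apply: chain_ext => n x; exact: gE.
Qed.

(** Homotopies on the summands assemble into one on the sum.  This gives the
    uniqueness half of the universal property up to homotopy. *)
Lemma sum_null_homotopic (Y : complex R) (g : chain_map sum_complex Y) :
  (forall i, null_homotopic (chain_comp g (sum_inj i))) -> null_homotopic g.
Proof.
move=> /(fun H i => cid (H i)) s.
pose t n := sval (cid (dsum_copair (fun i => sval (s i) n))).
have tE n i (x : X i n) : t n (dsum_inj (fun i => X i n) i x) = sval (s i) n x.
  by rewrite /t; case: cid.
exists t => n x.
apply: (dsum_linear_ext (f := g (n + 1))
   (g := (diff Y (n + 1) \o t (n + 1)) \+ (t n \o diff sum_complex n))) => i v /=.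
by rewrite dsum_map_inj !tE -(svalP (s i) n v).
Qed.

End SumComplex.

(** * Coproducts in the homotopy category *)

Section HomotopyCategory.
Variables (R : pzRingType) (F : lmodType R -> Prop).
Hypothesis F_dsum : forall (I : small_type) (V : I -> lmodType R),
  (forall i, F (V i)) -> F (dsum V).

Local Notation KF := (homotopy_category F).

Lemma null_homotopic_of_hom0 (A B : KF) (f : chain_map (sval A) (sval B)) :
  (htp_pi f : hom A B) = 0 -> null_homotopic f.
Proof. by rewrite -htp_pi0 => /htp_eqP; rewrite subr0. Qed.

Lemma zero_object_of_contractible (A : KF) :
  null_homotopic (chain_id (sval A)) -> is_zero_object A.
Proof.
move=> null_id; have id0 : idn A = 0.
  by rewrite -[RHS]htp_pi0; apply/htp_eqP; rewrite subr0.
move=> B; split=> f; first by rewrite -(comp_idr f) id0 comp_0r.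
by rewrite -(comp_idl f) id0 comp_0l.
Qed.

Section Coproduct.
Variables (I : small_type) (X : I -> KF).

Definition coprod : KF :=
  exist (fun Z : complex R => forall n, F (Z n))
    (sum_complex (fun i => sval (X i)))
    (fun n => F_dsum (fun i => svalP (X i) n)).

Definition coprod_inj i : hom (X i) coprod :=
  htp_pi (sum_inj (fun i => sval (X i)) i).

Lemma coprodP : is_coproduct coprod_inj.
Proof.
move=> Y f.
have [g gE] := sum_copair (fun i => repr (f i)).
exists (htp_pi g); split=> [i|].
  by rewrite [LHS]htp_compE gE; exact: reprK.
elim/htp_ind => g' g'E; apply/htp_eqP/sum_null_homotopic => i.
rewrite (_ : chain_comp _ _ = chain_comp g (sum_inj (fun i => sval (X i)) i)
  - chain_comp g' (sum_inj (fun i => sval (X i)) i)); last exact: chain_ext.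
apply/htp_eqP; rewrite -[RHS]htp_compE [RHS]g'E gE; exact: reprK.
Qed.

End Coproduct.

(** A chain map h with image in the summands X i, i in s, is already at the level
    of chains the sum of its components through these X i. *)
Lemma compact_of_finite_image (C : KF) :
    (forall (I : small_type) (X : I -> complex R)
        (h : chain_map (sval C) (sum_complex X)),
      exists s : seq {classic I}, uniq s /\
        forall i, i \notin s -> forall n x, dsum_proj (fun i => X i n) i (h n x) = 0) ->
  compact C.
Proof.
move=> finC; apply: compact_of_surj => I X.
exists (coprod X), (@coprod_inj I X); split; first exact: coprodP.
elim/htp_ind => h.
have [s [us h0]] := finC I (fun i => sval (X i)) h.
pose p i : chain_map (sval C) (sval (X i)) :=
  chain_comp (sum_proj (fun i => sval (X i)) i) h.
pose f i : hom C (X i) := htp_pi (p i).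
have f0 i : i \notin s -> f i = 0.
  move=> si; rewrite /f (_ : p i = 0) ?htp_pi0 //.
  by apply: chain_ext => n x /=; exact: h0.
exists (Dsum (@finite_family I (fun i => hom C (X i)) f s f0)).
rewrite (coproduct_comparisonE _ us) //.
transitivity (\sum_(i <- s) htp_pi
    (chain_comp (sum_inj (fun i => sval (X i)) i) (p i))).
  by apply: eq_bigr => i _; exact: htp_compE.
rewrite -htp_pi_sum; congr htp_pi; apply: chain_ext => n x.
rewrite chain_sumE /= [RHS](dsum_decomp us) // => i si; exact: h0.
Qed.

End HomotopyCategory.

(** * Complexes concentrated in one degree *)

Lemma fp_pure_projective (R : pzRingType) (M : lmodType R) :
  finitely_presented M -> pure_projective M.
Proof. by move=> fpM Y peY; exact: peY. Qed.

Lemma dsum_pure_projective (R : pzRingType) (I : small_type) (V : I -> lmodType R) :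
  (forall i, pure_projective (V i)) -> pure_projective (dsum V).
Proof. by move=> ppV Y peY; apply: hom_exact_dsum => i; exact: ppV. Qed.

Section Stalk.
Variables (R : pzRingType) (M : lmodType R) (m : int).

(** M in degree m and zero elsewhere.  The term in degree n is a sum of copies of
    M indexed by the proofs of m = n: maps out of it are given by the universal
    property of the sum. *)
Definition stalk : complex R :=
  @Complex R (fun n => dsum (fun _ : m = n => M)) (fun n => \0) (fun n x => erefl).

Definition stalk_inj n (e : m = n) : {linear M -> stalk n} :=
  dsum_inj_lin (fun _ : m = n => M) e.

Lemma stalk_linear_ext n (W : lmodType R) (f g : {linear stalk n -> W}) :
  (forall (e : m = n) v, f (stalk_inj e v) = g (stalk_inj e v)) -> f =1 g.
Proof. exact: dsum_linear_ext. Qed.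

(** The finitely many generators of M have images with finite supports. *)
Lemma stalk_finite_image (k : nat) (g : {linear 'rV[R]_k -> M}) :
    (forall y, exists x, g x = y) ->
  forall (I : small_type) (X : I -> complex R) (h : chain_map stalk (sum_complex X)),
    exists s : seq {classic I}, uniq s /\
      forall i, i \notin s -> forall n x, dsum_proj (fun i => X i n) i (h n x) = 0.
Proof.
move=> surj_g I X h.
have /choice[t tP] (j : 'I_k) : exists s : seq {classic I}, forall i, i \notin s ->
    dsum_proj (fun i => X i m) i (h m (stalk_inj erefl (g (delta_mx 0 j)))) = 0.
  by have [s [_ s0]] := dsum_support (h m (stalk_inj erefl (g (delta_mx 0 j)))); exists s.
exists (undup (flatten [seq t j | j : 'I_k])); split; first exact: undup_uniq.
move=> i; rewrite mem_undup => si n.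
apply: (stalk_linear_ext (f := dsum_proj_lin (fun i => X i n) i \o h n) (g := \0)).
move=> e; case: _ / e => v; have [w <-] := surj_g v.
pose L : {linear 'rV[R]_k -> X i m} :=
  dsum_proj_lin (fun i => X i m) i \o (h m \o (stalk_inj erefl \o g)).
rewrite /= -[LHS]/(L w) [w]row_sum_delta linear_sum big1 // => j _.
rewrite linearZ /= /dsum_proj_lin /= tP ?scaler0 //.
apply: contra si => it; apply/flattenP; exists (t j) => //.
by apply/mapP; exists j; rewrite ?mem_enum.
Qed.

End Stalk.

(** A map f from M to the cycles of X is a chain map from the stalk; since the
    stalk has zero differential, a null-homotopy of it is a lift of f. *)
Lemma stalk_detects (R : pzRingType) (M : lmodType R) (X : complex R) (n : int) :
    (forall phi : chain_map (stalk M (n + 1)) X, null_homotopic phi) ->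
  forall f : {linear M -> X (n + 1)}, (forall x, diff X n (f x) = 0) ->
    exists g : {linear M -> X (n + 1 + 1)}, forall x, diff X (n + 1) (g x) = f x.
Proof.
move=> null f df0.
pose F k (e : n + 1 = k) : {linear M -> X k} := ecast k {linear M -> X k} e f.
pose phi k := sval (cid (dsum_copair (F k))).
have phiE k (e : n + 1 = k) x : phi k (stalk_inj M e x) = F k e x.
  by rewrite /phi; case: cid => g /= ->.
have phiC k x : phi k (diff (stalk M (n + 1)) k x) = diff X k (phi (k + 1) x).
  rewrite linear0; symmetry.
  apply: (stalk_linear_ext (f := diff X k \o phi (k + 1)) (g := \0)) => e v /=.
  rewrite phiE; have nk : n = k by apply: (addIr 1).
  by case: _ / nk in e *; rewrite (Prop_irrelevance e erefl) df0.
have [s sE] := null (ChainMap phiC).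
exists (s (n + 1) \o stalk_inj M erefl) => x.
by have /= := sE n (stalk_inj M erefl x); rewrite phiE linear0 addr0 => <-.
Qed.

(** * A set of finitely presented modules *)

Section Presentations.
Variable R : pzRingType.

Definition presents k l (f : 'rV[R]_k -> 'rV[R]_l) (N : lmodType R) : Prop :=
  exists g : {linear 'rV[R]_l -> N},
    (forall y, exists x, g x = y) /\ (forall x, g x = 0 <-> exists z, f z = x).

Lemma presents_iso k l (f : 'rV[R]_k -> 'rV[R]_l) (N N' : lmodType R) :
    presents f N -> presents f N' ->
  exists (u : {linear N -> N'}) (v : {linear N' -> N}), cancel u v.
Proof.
move=> [g [surj_g kg]] [g' [surj_g' kg']].
have [u uE] := factor_through surj_g (fun x gx0 => (kg' x).2 ((kg x).1 gx0)).
have [v vE] := factor_through surj_g' (fun x gx0 => (kg x).2 ((kg' x).1 gx0)).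
by exists u, v => y; have [x <-] := surj_g y; rewrite uE vE.
Qed.

Lemma hom_exact_retract (N N' : lmodType R) (u : {linear N -> N'})
    (v : {linear N' -> N}) (Y : complex R) :
  cancel u v -> hom_exact N' Y -> hom_exact N Y.
Proof.
move=> uv N'Y n f df0.
have [g gE] := N'Y n (f \o v) (fun x => df0 (v x)).
by exists (g \o u) => x; rewrite /= gE /= uv.
Qed.

(** Bare functions, so that presentations form a small type: the maps that do
    not present a module are discarded in the next definition. *)
Definition presentation := {k : nat & {l : nat & 'rV[R]_k -> 'rV[R]_l}}.

Definition fp_index : small_type :=
  {p : presentation | exists N : lmodType R,
    finitely_presented N /\ presents (projT2 (projT2 p)) N}.

(** Some module with the given presentation; any two are isomorphic. *)
Definition fp_module (p : fp_index) : lmodType R := sval (cid (svalP p)).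

Lemma fp_module_fp p : finitely_presented (fp_module p).
Proof. by rewrite /fp_module; case: cid => N []. Qed.

Lemma fp_module_complete (N : lmodType R) : finitely_presented N ->
  exists (p : fp_index) (u : {linear N -> fp_module p}) (v : {linear fp_module p -> N}),
    cancel u v.
Proof.
move=> fpN; have [k [l [f [g gP]]]] := fpN.
have fN : presents f N by exists g.
pose p : fp_index := exist (fun p : presentation => exists N : lmodType R,
    finitely_presented N /\ presents (projT2 (projT2 p)) N)
  (existT _ k (existT _ l (f : _ -> _))) (ex_intro _ N (conj fpN fN)).
exists p; apply: (presents_iso fN).
by rewrite /fp_module; case: cid => N' [].
Qed.

End Presentations.

(** * Pure exact complexes of pure projectives *)

(** A homotopy is compared with differentials X (n + 1) -> X n, while its own
    components are indexed by all degrees; this passes from successors to all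
    degrees without transports in the statements. *)
Lemma int_succ_rect (P : int -> Type) (H : forall n : int, P (n + 1)) :
  {F : forall n, P n | forall n, F (n + 1) = H n}.
Proof.
exists (fun n => ecast k (P k) (subrK 1 n) (H (n - 1))) => n.
move: (n + 1 - 1) (subrK 1 (n + 1)) => m e.
by have mn : m = n := addIr 1 e; case: _ / (esym mn) in e *; rewrite (Prop_irrelevance e erefl).
Qed.

Lemma int_succ (n : int) : exists m, n = m + 1.
Proof. by exists (n - 1); rewrite subrK. Qed.

Section Contraction.
Variables (R : pzRingType) (X : complex R).
Hypothesis peX : pure_exact X.
Hypothesis ppX : forall n, pure_projective (X n).

(** A section s of the differential over its image. *)
Definition splits (n : int) : Prop :=
  exists s : {linear X n -> X (n + 1)},
    forall x, diff X n (s (diff X n x)) = diff X n x.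

(** The sections s are corrected to h = s (1 - s d).  The map 1 - s d takes its
    values in the cycles; by pure projectivity of the terms it factors as d t, so
    that d h = d s d t = d t = 1 - s d.  Moreover h d = s d. *)
Lemma null_homotopic_of_splits :
  (forall n, splits n) -> null_homotopic (chain_id X).
Proof.
move=> /(fun H n => cid (H n)) split.
pose s n : {linear X n -> X (n + 1)} := sval (split n).
have sP n x : diff X n (s n (diff X n x)) = diff X n x.
  by rewrite /s; case: (split n).
pose w n : {linear X (n + 1) -> X (n + 1)} := idfun \- (s n \o diff X n).
have [h hE] := @int_succ_rect (fun k => {linear X k -> X (k + 1)})
  (fun n => s (n + 1) \o w n).
exists h => n x; rewrite hE.
have -> : h n (diff X n x) = s n (diff X n x).
  have [m nE] := int_succ n; case: _ / (esym nE) in x *.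
  by rewrite hE /= diff_diff linear0 subr0.
have [y|t tE] := ppX peX (f := w n); first by rewrite /= linearB sP subrr.
by rewrite /= -[x - _]/(w n x) -tE sP tE /= subrK.
Qed.

Section Comparison.
Variable P : complex R.
Hypothesis peP : pure_exact P.

(** One degree of the comparison of X with P: maps g and f in degrees k + 1 and
    l + 1 that can be extended upwards, and a homotopy s.  The homotopy relation
    1 = f g + d s + s' d is only recorded on the image of d, where the last term
    vanishes.  This is all that the next degree needs, so the whole comparison can
    be built by induction on an existential statement. *)
Definition comparison (k l : int) : Prop :=
  exists (g : {linear X (k + 1) -> P (l + 1)}) (f : {linear P (l + 1) -> X (k + 1)})
         (s : {linear X (k + 1) -> X (k + 1 + 1)}),
    [/\ forall x, diff P l (g (diff X (k + 1) x)) = 0,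
        forall y, diff X k (f (diff P (l + 1) y)) = 0 &
        forall x, let y := diff X (k + 1) x in
          y = f (g y) + diff X (k + 1) (s y)].

(** The maps g d, f d and 1 - f' g' - s d are killed by the differential, so they
    lift through it: to g' and f' since the terms of X and P are pure projective,
    and to the next homotopy s'. *)
Lemma comparison_step k l : pure_projective (P (l + 1 + 1)) ->
  comparison k l -> comparison (k + 1) (l + 1).
Proof.
move=> ppP [g [f [s [dgd dfd htp]]]].
have [x|g' g'E] := ppX peP (f := g \o diff X (k + 1)); first exact: dgd.
have [y|f' f'E] := ppP X peX k (f \o diff P (l + 1)); first exact: dfd.
pose w : {linear X (k + 1 + 1) -> X (k + 1 + 1)} :=
  idfun \- ((f' \o g') \+ (s \o diff X (k + 1))).
have [x|s' s'E] := ppX peX (f := w).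
  rewrite /= linearB linearD /= f'E /= g'E /=.
  by apply/eqP; rewrite subr_eq0; apply/eqP; exact: htp.
exists g', f', s'; split=> [x|y|x /=].
- by rewrite g'E /= diff_diff linear0.
- by rewrite f'E /= diff_diff linear0.
by rewrite s'E /= diff_diff linear0 addr0 [RHS]addrC subrK.
Qed.

(** P (l + 1) is the module of cycles of X in degree m + 1, and g, f lift its
    identity to the terms above it.  P l = 0 makes the lift along
    P (l + 2) -> P (l + 1) possible. *)
Lemma comparison_base m l (e : {linear P (l + 1) -> kernel (diff X m)}) :
    (forall x : P l, x = 0) -> pure_projective (P (l + 1 + 1)) -> bijective e ->
  comparison (m + 1) (l + 1).
Proof.
move=> Pl0 ppP /linear_bij_inv[e' [ee' e'e]].
have [c cE] := kernel_lift (diff_diff (c := X) (n := m)).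
have [x|g gE] := ppX peP (f := e' \o c); first exact: Pl0.
pose i : {linear kernel (diff X m) -> X (m + 1)} := val.
have [y|f fE] := ppP X peX m (i \o e \o diff P (l + 1)); first exact: kernelP.
have cd x : c (diff X (m + 1 + 1) x) = 0.
  by apply: val_inj; rewrite cE diff_diff.
pose w : {linear X (m + 1 + 1) -> X (m + 1 + 1)} := idfun \- (f \o g).
have [x|s sE] := ppX peX (f := w).
  by rewrite /= linearB /= fE /= gE /= e'e cE subrr.
exists g, f, s; split=> [x|y|x /=].
- by rewrite gE /= cd linear0.
- by rewrite fE /= diff_diff linear0.
by rewrite sE /= [RHS]addrC subrK.
Qed.

Lemma splits_of_comparison k l :
  (forall x : P (l + 1), x = 0) -> comparison k l -> splits (k + 1).
Proof.
move=> Pl0 [g [f [s [_ _ htp]]]]; exists s => x.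
by rewrite [RHS]htp (Pl0 (g _)) linear0 add0r.
Qed.

End Comparison.

(** The iterated successor makes shift n i.+1 convertible to shift n i + 1, the
    form of the degrees in a differential. *)
Fixpoint shift (n : int) (i : nat) : int := if i is j.+1 then shift n j + 1 else n.

Lemma shiftE n i : shift n i = n + i%:Z.
Proof. by elim: i => [|i IHi] /=; rewrite ?addr0 // IHi -addrA -addn1 PoszD. Qed.

Lemma pure_exact_contractible d :
  pure_resolutions_of_length R d -> null_homotopic (chain_id X).
Proof.
move=> resR; apply: null_homotopic_of_splits => n.
(* The cycles are taken so low that P is compared with degree n above its length. *)
have [m ->] : exists m, n = shift (m + 1) d.+1 + 1.
  by exists (n - 1 - d.+1%:Z - 1); rewrite shiftE !subrK.
have [P [peP [e bij_e] ppP P0]] := resR (kernel (diff X m)).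
have {}ppP (i : nat) : pure_projective (P i%:Z).
  have [/ppP//|di] := leqP i d.
  move=> Y _ q f _; exists \0 => x.
  by rewrite (P0 i%:Z (or_intror di) x) !linear0.
have shiftN1 i : shift (-1) i.+1 = i%:Z.
  by rewrite shiftE -addn1 PoszD addrC addrK.
apply: (@splits_of_comparison P _ (shift (-1) d.+1)).
  by move=> x; apply: P0; right; rewrite -[_ + 1]/(shift (-1) d.+2) shiftN1 ltz_nat.
(* The comparison starts at P (-2) = 0, as -2 + 1 is convertible to -1. *)
elim: d.+1 => [|i IHi] /=.
  apply: (@comparison_base P peP m (-2) e) => //; last exact: (ppP 0).
  by apply: P0; left.
apply: comparison_step => //.
by rewrite -[_ + 1 + 1]/(shift (-1) i.+2) shiftN1.
Qed.

End Contraction.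

(** * Compact generation *)

Theorem K_PureProj_compactly_generated (R : pzRingType) (d : nat) :
  pure_resolutions_of_length R d -> compactly_generated (K_PureProj R).
Proof.
move=> resR; split=> [I X|].
  by exists (coprod (@dsum_pure_projective R) X); eexists; exact: coprodP.
pose G (j : fp_index R * int) : K_PureProj R :=
  exist (fun Z : complex R => forall n, pure_projective (Z n))
    (stalk (fp_module j.1) j.2)
    (fun n => dsum_pure_projective
      (fun _ => fp_pure_projective (fp_module_fp j.1))).
exists (fp_index R * int)%type, G; split=> [[p m]|X GX0].
  apply: (compact_of_finite_image (@dsum_pure_projective R)) => I X h.
  have [k [l [_ [g [surj_g _]]]]] := fp_module_fp p.
  exact: stalk_finite_image surj_g I X h.
have peX : pure_exact (sval X).
  move=> N /fp_module_complete[p [u [v uv]]].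
  apply: (hom_exact_retract uv) => n.
  apply: stalk_detects => phi.
  exact: (@null_homotopic_of_hom0 _ _ (G (p, n + 1)) X phi (GX0 _ _)).
exact/zero_object_of_contractible/(pure_exact_contractible peX (svalP X) resR).
Qed.

(** Elements are maps from the finitely presented module R. *)
Lemma exact_of_pure_exact (R : pzRingType) (Y : complex R) :
  pure_exact Y -> forall n (x : Y (n + 1)), diff Y n x = 0 ->
  exists y, diff Y (n + 1) y = x.
Proof.
move=> peY n x dx0.
have fpR : finitely_presented 'rV[R]_1.
  exists 0%N, 1%N, \0, idfun; split=> [y|y]; first by exists y.
  by split=> [/= ->|[z <-]] //; exists 0.
have [a u v|f fE] := @linear_of R 'rV[R]_1 (Y (n + 1)) (fun r => r 0 0 *: x).
  by rewrite !mxE scalerDl scalerA.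
have [r|g gE] := peY _ fpR n f; first by rewrite fE linearZ /= dx0 scaler0.
by exists (g (const_mx 1)); rewrite gE fE mxE scale1r.
Qed.

(** A resolution of length 0 is an isomorphism from a pure projective module. *)
Lemma pure_projective_of_length0 (R : pzRingType) (N : lmodType R) :
  has_pure_resolution N 0 -> pure_projective N.
Proof.
move=> [Y [peY [e /linear_bij_inv[e' [_ e'e]]] ppY Y0]].
have surj (z : Y (-1)) : exists y, diff Y (-1) y = z.
  by apply: (@exact_of_pure_exact R Y peY (-2)); apply: Y0; left.
have inj (y : Y 0) : diff Y (-1) y = 0 -> y = 0.
  move=> /(@exact_of_pure_exact R Y peY (-1))[t <-].
  by rewrite (Y0 _ _ t) ?linear0 //; right.
move=> X peX; apply: (hom_exact_retract e'e) => n f df0.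
have [y|g gE] := ppY 0%N isT X peX n (f \o diff Y (-1)); first exact: df0.
have [y /inj->|k kE] := factor_through surj (h := g); first exact: linear0.
by exists k => z; have [y <-] := surj z; rewrite kE gE.
Qed.

Theorem mainTheorem4 (R : pzRingType) :
  (finite_pure_gldim R -> compactly_generated (K_PureProj R)) /\
  (left_pure_semisimple R -> compactly_generated (K_Mod R)).
Proof.
rewrite /finite_pure_gldim /left_pure_semisimple /pure_gldim.
case: pselect => [ex_d|//]; case: ex_minnP => d /asboolP resR _.
split=> [_|[d0]]; first exact: K_PureProj_compactly_generated resR.
rewrite /K_Mod (_ : (fun _ => True) = @pure_projective R).
  exact: K_PureProj_compactly_generated resR.
apply/funext => N; apply/propext; split=> // _.
by apply: pure_projective_of_length0; rewrite -d0; exact: resR.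
Qed.
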